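(* For the family $\mathcal{R} = \mathcal{R}_{\rm BL} \cup \mathcal{R}_{\rm TL}$ of all bottomless and topless rectangles, we have $m_{\mathcal{R}}(k) \leq O(k^{8.75})$ for all $k$; i.e., there is a constant $C$ such that $m_{\mathcal{R}}(k) \leq C k^{8.75}$ for all $k \geq 1$.
   Context: $\mathcal{R}_{\rm BL} = \{\{(x,y) : a_1 \leq x \leq a_2,\ y \leq b\} : a_1,a_2,b \in \mathbb{R}\}$ and $\mathcal{R}_{\rm TL} = \{\{(x,y) : a_1 \leq x \leq a_2,\ y \geq b\} : a_1,a_2,b \in \mathbb{R}\}$. For finite $V \subset \mathbb{R}^2$, $\mathcal{H}(V,\mathcal{R},m)$ is the hypergraph on $V$ whose hyperedges are the sets $V \cap R$, $R \in \mathcal{R}$, of size exactly $m$. A $k$-coloring is polychromatic if every hyperedge contains all $k$ colors. Point sets are in general position (pairwise distinct $x$-coordinates, $y$-coordinates and values $x+y$). $m_{\mathcal{R}}(k)$ is the smallest $m$ such that for every finite $V$ in general position $\mathcal{H}(V,\mathcal{R},m)$ admits a polychromatic $k$-coloring. *)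

(* Defs.v *)
From Stdlib Require Import Reals List.
Import ListNotations.
Open Scope R_scope.

Definition point : Type := (R * R)%type.

Definition Rleb (x y : R) : bool := if Rle_dec x y then true else false.

Inductive rect : Type :=
  | BL (a1 a2 b : R)
  | TL (a1 a2 b : R).

Definition in_rect (r : rect) (p : point) : bool :=
  match r with
  | BL a1 a2 b => Rleb a1 (fst p) && Rleb (fst p) a2 && Rleb (snd p) b
  | TL a1 a2 b => Rleb a1 (fst p) && Rleb (fst p) a2 && Rleb b (snd p)
  end.

(* A finite point set V is represented by a duplicate-free list. *)
Definition general_position (V : list point) : Prop :=
  forall p q, In p V -> In q V -> p <> q ->
    fst p <> fst q /\ snd p <> snd q /\ fst p + snd p <> fst q + snd q.

Definition cut (V : list point) (r : rect) : list point := filter (in_rect r) V.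

Definition polychromatic (V : list point) (m k : nat) (c : point -> nat) : Prop :=
  (forall p, In p V -> (c p < k)%nat) /\
  forall r : rect, length (cut V r) = m ->
    forall i, (i < k)%nat -> exists p, In p (cut V r) /\ c p = i.

Definition good_m (k m : nat) : Prop :=
  forall V : list point, NoDup V -> general_position V ->
    exists c : point -> nat, polychromatic V m k c.

(* Main.v *)
(** Sort the points by x-coordinate. A bottomless rectangle then cuts out a contiguous block of the points below some height, a topless one a contiguous block of the points above some height.

    For bottomless rectangles alone there is a 2-colouring in which every block of 4 points has both colours: insert the points by increasing height, leave some of them uncoloured, and keep the colours alternating with no two adjacent uncoloured points. A block of [4 n] points splits into [n] blocks of 4 points, so iterating on the colour classes gives [2 ^ j] colours in every block of [4 ^ j] points.

    To treat both families at once, colour red the points lower than their two neighbours, blue those higher than their two neighbours, and alternate along monotone runs. Every bottomless block of 11 points contains a red point and every topless one a blue point. It remains to colour the red points for the bottomless rectangles and the blue points for the topless ones, which gives a bound quadratic in [k]. *)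

Require Import Defs.
From Stdlib Require Import Reals List.
From Stdlib Require Import Lra Lia Permutation Sorting.Sorted ClassicalEpsilon.
Import ListNotations.
Open Scope R_scope.

(** * Filters, recolouring, and windows of low points *)

Lemma Rleb_true (x y : R) : Rleb x y = true <-> x <= y.
Proof. unfold Rleb. destruct (Rle_dec x y); split; intros; easy. Qed.

Lemma Rleb_false (x y : R) : Rleb x y = false <-> y < x.
Proof. unfold Rleb. destruct (Rle_dec x y); split; intros; try easy; lra. Qed.

Lemma Rleb_opp (x y : R) : Rleb (- x) (- y) = Rleb y x.
Proof. unfold Rleb. destruct (Rle_dec (- x) (- y)), (Rle_dec y x); try easy; lra. Qed.

Lemma filter_comm (A : Type) (g h : A -> bool) (l : list A) :
  filter g (filter h l) = filter h (filter g l).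
Proof.
  induction l as [|a l IH]; [easy|]. simpl.
  destruct (g a) eqn:Eg, (h a) eqn:Eh; simpl; rewrite ?Eg, ?Eh, IH; easy.
Qed.

Lemma filter_andb (A : Type) (g h : A -> bool) (l : list A) :
  filter (fun p => g p && h p)%bool l = filter g (filter h l).
Proof.
  induction l as [|a l IH]; [easy|]. simpl.
  destruct (h a); simpl; destruct (g a); simpl; now rewrite IH.
Qed.

Lemma filter_eq_app (A : Type) (g : A -> bool) (l u v : list A) :
  filter g l = u ++ v ->
  exists l1 l2, l = l1 ++ l2 /\ filter g l1 = u /\ filter g l2 = v.
Proof.
  revert u. induction l as [|a l IH]; simpl; intros u H.
  - symmetry in H. apply app_eq_nil in H as [-> ->]. exists [], []. easy.
  - destruct (g a) eqn:E.
    + destruct u as [|b u]; simpl in H.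
      * exists [], (a :: l). simpl. rewrite E. easy.
      * injection H as <- H. destruct (IH u H) as (l1 & l2 & -> & <- & <-).
        exists (a :: l1), l2. simpl. rewrite E. easy.
    + destruct (IH u H) as (l1 & l2 & -> & <- & <-).
      exists (a :: l1), l2. simpl. rewrite E. easy.
Qed.

Lemma filter_true (A : Type) (g : A -> bool) (l : list A) :
  (forall p, In p l -> g p = true) -> filter g l = l.
Proof.
  induction l as [|a l IH]; simpl; intros H; [easy|].
  rewrite H by (left; reflexivity). f_equal. auto.
Qed.

Lemma first_false (A : Type) (g : A -> bool) (l : list A) :
  (forall p, In p l -> g p = true) \/
  exists u z v, l = u ++ z :: v /\ g z = false /\ forall p, In p u -> g p = true.
Proof.
  induction l as [|a l IH]; [left; easy|].
  destruct (g a) eqn:E.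
  - destruct IH as [IH|(u & z & v & -> & Hz & Hu)].
    + left. intros p [<-|H]; auto.
    + right. exists (a :: u), z, v. repeat split; auto. intros p [<-|H]; auto.
  - right. exists [], a, l. easy.
Qed.

Lemma last_false (A : Type) (g : A -> bool) (l : list A) :
  (forall p, In p l -> g p = true) \/
  exists u z v, l = u ++ z :: v /\ g z = false /\ forall p, In p v -> g p = true.
Proof.
  destruct (first_false A g (rev l)) as [H|(u & z & v & E & Hz & Hu)].
  - left. intros p Hp. apply H. now apply -> in_rev.
  - right. exists (rev v), z, (rev u). repeat split; auto.
    + rewrite <- (rev_involutive l), E, rev_app_distr. simpl. now rewrite <- app_assoc.
    + intros p Hp. apply Hu. now apply in_rev.
Qed.

Lemma exists_lowest (A : Type) (f : A -> R) (l : list A) :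
  l <> [] -> exists q, In q l /\ forall p, In p l -> f q <= f p.
Proof.
  induction l as [|a l IH]; [easy|]. intros _.
  destruct l as [|b l].
  - exists a. split; [now left|]. intros p [<-|[]]. lra.
  - destruct IH as (q & Hq & Hmin); [easy|].
    destruct (Rle_dec (f a) (f q)).
    + exists a. split; [now left|]. intros p [<-|Hp]; [lra|].
      specialize (Hmin p Hp). lra.
    + exists q. split; [now right|]. intros p [<-|Hp]; [lra|auto].
Qed.

Definition update (A B : Type) (c : A -> B) (p : A) (b : B) (q : A) : B :=
  if excluded_middle_informative (q = p) then b else c q.

Lemma update_same (A B : Type) (c : A -> B) (p : A) (b : B) : update A B c p b p = b.
Proof. unfold update. now destruct excluded_middle_informative. Qed.

Lemma update_other (A B : Type) (c : A -> B) (p q : A) (b : B) :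
  q <> p -> update A B c p b q = c q.
Proof. unfold update. now destruct excluded_middle_informative. Qed.

Lemma map_update (A B : Type) (c : A -> B) (p : A) (b : B) (l : list A) :
  ~ In p l -> map (update A B c p b) l = map c l.
Proof. intros H. apply map_ext_in. intros q Hq. apply update_other. congruence. Qed.

(** Without duplicates a point determines its position, so a colour may be prescribed by
    position. *)
Lemma coloring_by_index (A B : Type) (d : A) (g : nat -> B) (l : list A) :
  NoDup l ->
  exists c : A -> B, forall i, (i < length l)%nat -> c (nth i l d) = g i.
Proof.
  revert g. induction l as [|a l IH]; intros g Hl.
  - exists (fun _ => g 0%nat). simpl. lia.
  - inversion_clear Hl as [|? ? Ha Hl'].
    destruct (IH (fun i => g (S i)) Hl') as [c Hc].
    exists (update A B c a (g 0%nat)). intros [|i] Hi; simpl in *.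
    + apply update_same.
    + rewrite update_other; [apply Hc; lia|].
      intros E. apply Ha. rewrite <- E. apply nth_In. lia.
Qed.

(** With [L] ordered by x-coordinate and [f] the height, this models what a bottomless rectangle
    cuts out; negated heights model topless ones. *)
Definition low_window (A : Type) (f : A -> R) (L W : list A) : Prop :=
  exists b P S, filter (fun p => Rleb (f p) b) L = P ++ W ++ S.

Lemma low_window_app (A : Type) (f : A -> R) (L W1 W2 : list A) :
  low_window A f L (W1 ++ W2) -> low_window A f L W1 /\ low_window A f L W2.
Proof.
  intros (b & P & S & H). split.
  - exists b, P, (W2 ++ S). now rewrite H, <- app_assoc.
  - exists b, (P ++ W1), S. now rewrite H, <- !app_assoc.
Qed.

Lemma low_window_incl (A : Type) (f : A -> R) (L W : list A) (p : A) :
  low_window A f L W -> In p W -> In p L.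
Proof.
  intros (b & P & S & H) Hp.
  apply (incl_filter (fun p => Rleb (f p) b)). rewrite H, !in_app_iff. auto.
Qed.

(** Filters commute, so a window restricts to a window of each colour class. This is what allows
    iterating on the classes. *)
Lemma low_window_filter (A : Type) (f : A -> R) (g : A -> bool) (L W : list A) :
  low_window A f L W -> low_window A f (filter g L) (filter g W).
Proof.
  intros (b & P & S & H). exists b, (filter g P), (filter g S).
  now rewrite filter_comm, H, !filter_app.
Qed.

(** Consecutive pieces of a window are windows for the same bound [b], so each piece of [s] points
    contributes its own point satisfying [g]. *)
Lemma low_window_count (A : Type) (f : A -> R) (g : A -> bool) (L : list A) (s : nat) :
  (forall W, low_window A f L W -> (s <= length W)%nat ->
     exists p, In p W /\ g p = true) ->
  forall m W, low_window A f L W -> (s * m <= length W)%nat ->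
    (m <= length (filter g W))%nat.
Proof.
  intros Hs. induction m as [|m IH]; intros W HW Hlen; [lia|].
  rewrite <- (firstn_skipn s W) in HW |- *.
  apply low_window_app in HW as [H1 H2].
  rewrite filter_app, length_app.
  assert (m <= length (filter g (skipn s W)))%nat.
  { apply IH; [easy|]. rewrite length_skipn. lia. }
  destruct (Hs _ H1) as (p & Hp & Hg).
  { rewrite length_firstn. lia. }
  assert (Hin : In p (filter g (firstn s W))) by now apply filter_In.
  destruct (filter g (firstn s W)); simpl in *; [easy|lia].
Qed.

(** * Colouring for bottomless rectangles *)

(* A state records the last colour read and whether the last point read is uncoloured. [run] succeeds on the words whose colours alternate and in which no two adjacent points are uncoloured. *)
Definition step (s : option bool * bool) (a : option bool) : option (option bool * bool) :=
  match s, a with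
  | (_, true), None => None
  | (lc, false), None => Some (lc, true)
  | (Some true, _), Some true | (Some false, _), Some false => None
  | _, Some x => Some (Some x, false)
  end.

Fixpoint run (s : option bool * bool) (w : list (option bool)) : option (option bool * bool) :=
  match w with
  | [] => Some s
  | a :: w' => match step s a with Some s' => run s' w' | None => None end
  end.

Lemma run_app (s : option bool * bool) (u v : list (option bool)) :
  run s (u ++ v) = match run s u with Some s' => run s' v | None => None end.
Proof.
  revert s. induction u as [|a u IH]; intros s; simpl; [easy|].
  destruct (step s a); [apply IH|easy].
Qed.

(** Among four consecutive points at least two are coloured, and successive colours differ. Three
    would not suffice: the middle one may be the only coloured point. *)
Lemma run_both_colors (s : option bool * bool) (u v w : list (option bool)) (x : bool) :
  run s (u ++ v ++ w) <> None -> (4 <= length v)%nat -> In (Some x) v.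
Proof.
  rewrite run_app. destruct (run s u) as [s'|]; [|easy]. rewrite run_app.
  intros H. assert (H' : run s' v <> None) by now destruct (run s' v). clear H.
  destruct v as [|a1 [|a2 [|a3 [|a4 v]]]]; simpl; intros; try lia.
  destruct s' as [[[]|] []], a1 as [[]|]; simpl in H'; try easy;
  destruct a2 as [[]|]; simpl in H'; try easy;
  destruct a3 as [[]|]; simpl in H'; try easy;
  destruct a4 as [[]|]; simpl in H'; try easy;
  destruct x; tauto.
Qed.

(** An uncoloured point between [u] and [v] is replaced by two coloured ones. If [v] starts with
    colour [y], the pair [y], [negb y] fits, because [y] already differs from the last colour of
    [u]. *)
Lemma run_color_pair (s : option bool * bool) (lc : option bool) (u v : list (option bool)) :
  run s u = Some (lc, false) -> run (lc, true) v <> None ->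
  exists a b, run s (u ++ Some a :: Some b :: v) <> None.
Proof.
  intros Hu Hv.
  destruct v as [|[y|] v]; [| |now destruct lc as [[]|]].
  - exists (match lc with Some x => negb x | None => true end),
      (match lc with Some x => x | None => false end).
    rewrite run_app, Hu. now destruct lc as [[]|].
  - exists y, (negb y). rewrite run_app, Hu.
    destruct lc as [[]|], y; simpl in *; easy.
Qed.

Lemma color_pair (A : Type) (c : A -> option bool) (X Y : list A) (p r : A)
    (s : option bool * bool) (lc : option bool) :
  NoDup (X ++ p :: r :: Y) ->
  run s (map c X) = Some (lc, false) -> run (lc, true) (map c Y) <> None ->
  exists c' : A -> option bool, run s (map c' (X ++ p :: r :: Y)) <> None /\
    forall q, q <> p -> q <> r -> c' q = c q.
Proof.
  intros Hnd HX HY.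
  destruct (run_color_pair _ _ _ _ HX HY) as (a & b & Hab).
  pose proof (NoDup_remove_2 _ _ _ Hnd) as Hp.
  pose proof (NoDup_remove_2 (X ++ [p]) Y r) as Hr.
  rewrite <- !app_assoc in Hr. specialize (Hr Hnd).
  rewrite in_app_iff in Hp, Hr. simpl in Hp, Hr.
  exists (update A _ (update A _ c p (Some a)) r (Some b)). split.
  - rewrite map_app. simpl.
    rewrite (update_other _ _ _ r p) by (intros ->; tauto).
    rewrite !update_same, !map_update by tauto. exact Hab.
  - intros q Hqp Hqr. now rewrite !update_other.
Qed.

(** The new point stays uncoloured unless a neighbour is uncoloured; then it and that neighbour both
    receive colours. Colours once given never change. *)
Lemma insert_uncolored (A : Type) (c : A -> option bool) (X Y : list A) (p : A) :
  NoDup (X ++ p :: Y) -> run (None, false) (map c (X ++ Y)) <> None ->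
  exists c' : A -> option bool, run (None, false) (map c' (X ++ p :: Y)) <> None /\
    forall q, In q (X ++ Y) -> forall x, c q = Some x -> c' q = Some x.
Proof.
  intros Hnd Hrun.
  pose proof (NoDup_remove_2 _ _ _ Hnd) as Hp.
  rewrite map_app, run_app in Hrun.
  destruct (run (None, false) (map c X)) as [[lc [|]]|] eqn:HX; [| |easy].
  - destruct (exists_last (l := X)) as (X' & r & ->); [now intros ->|].
    rewrite map_app, run_app in HX.
    destruct (run (None, false) (map c X')) as [[lc' fl]|] eqn:HX'; [|easy].
    assert (c r = None /\ fl = false /\ lc' = lc) as (Hr & -> & ->).
    { simpl in HX. destruct lc' as [[]|], fl, (c r) as [[]|]; simpl in HX;
        try discriminate; injection HX as <-; auto. }
    rewrite <- app_assoc in Hnd. simpl in Hnd.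
    destruct (color_pair _ _ _ _ _ _ _ _ Hnd HX' Hrun) as (c' & Hc' & E).
    exists c'. split; [now rewrite <- app_assoc|].
    intros q Hq x Hx. rewrite E; [easy|congruence|now intros ->].
  (* The outer [None] means that [p] is last in the list; [Some None] means that its right neighbour
     is uncoloured. *)
  - destruct (match Y with [] => None | r :: _ => Some (c r) end) as [[|]|] eqn:HY.
    2:{ destruct Y as [|r Y]; [easy|]. injection HY as Hr.
        simpl in Hrun. rewrite Hr in Hrun.
        assert (Hrun' : run (lc, true) (map c Y) <> None)
          by now destruct lc as [[]|].
        destruct (color_pair _ _ _ _ _ _ _ _ Hnd HX Hrun') as (c' & Hc' & E).
        exists c'. split; [easy|].
        intros q Hq x Hx. rewrite E; [easy|now intros ->|congruence]. }
    all: exists (update A _ c p None); split;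
      [|intros q Hq x Hx; rewrite update_other; [easy|now intros ->]].
    all: rewrite in_app_iff in Hp; rewrite map_app; simpl;
      rewrite update_same, !map_update, run_app, HX by tauto.
    + destruct Y as [|r Y]; [easy|]. injection HY as Hr.
      simpl in *. rewrite Hr in *. now destruct lc as [[]|], b.
    + destruct Y as [|r Y]; [|easy]. now destruct lc as [[]|].
Qed.

(** Induction removes the highest point [p]. A window with bound below [f p] is a window of the
    other points, whose colours persist; with a higher bound all points are low, and the window is a
    block of the whole alternating word. *)
Lemma partial_coloring (A : Type) (f : A -> R) (L : list A) :
  NoDup L ->
  exists c : A -> option bool, run (None, false) (map c L) <> None /\
    forall W, low_window A f L W -> (4 <= length W)%nat ->
      forall x, In (Some x) (map c W).
Proof.
  remember (length L) as n eqn:Hn. revert L Hn.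
  induction n as [|n IH]; intros L Hn Hnd.
  - destruct L; [|easy]. exists (fun _ => None). split; [easy|].
    intros W HW Hlen. destruct W as [|a W]; simpl in Hlen; [lia|].
    now destruct (low_window_incl A f [] (a :: W) a HW (or_introl eq_refl)).
  - destruct (exists_lowest A (fun p => - f p) L) as (p & Hp & Hmax).
    { now intros ->. }
    destruct (in_split _ _ Hp) as (X & Y & ->).
    destruct (IH (X ++ Y)) as (c & Hrun & Hc).
    { rewrite length_app in *. simpl in Hn. lia. }
    { now apply NoDup_remove_1 in Hnd. }
    destruct (insert_uncolored _ _ _ _ _ Hnd Hrun) as (c' & Hrun' & Href).
    exists c'. split; [easy|]. intros W (b & P & S & HW) Hlen x.
    destruct (Rle_dec (f p) b) as [Hb|Hb].
    + rewrite filter_true in HW.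
      * rewrite HW, !map_app in Hrun'.
        apply (run_both_colors _ _ _ _ x Hrun'). now rewrite length_map.
      * intros q Hq. apply Rleb_true. specialize (Hmax q Hq). simpl in Hmax. lra.
    + assert (Hlow : low_window A f (X ++ Y) W).
      { exists b, P, S. rewrite <- HW, !filter_app. simpl.
        now rewrite (proj2 (Rleb_false (f p) b)) by lra. }
      specialize (Hc W Hlow Hlen x). apply in_map_iff in Hc as (q & Hq & HqW).
      apply in_map_iff. exists q. split; [|easy].
      apply Href; [|easy]. exact (low_window_incl _ _ _ _ _ Hlow HqW).
Qed.

Lemma two_coloring (A : Type) (f : A -> R) (L : list A) :
  NoDup L ->
  exists c : A -> bool,
    forall W, low_window A f L W -> (4 <= length W)%nat ->
      forall x, exists p, In p W /\ c p = x.
Proof.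
  intros Hnd. destruct (partial_coloring A f L Hnd) as (c & _ & Hc).
  (* Uncoloured points get an arbitrary colour: the windows in question already show both
     colours. *)
  exists (fun p => match c p with Some x => x | None => true end).
  intros W HW Hlen x. specialize (Hc W HW Hlen x).
  apply in_map_iff in Hc as (p & Hp & HpW). exists p. now rewrite Hp.
Qed.

(** A window of [4 * 4 ^ j] points contains [4 ^ j] points of each of the two colours, enough for
    induction on both classes. The second class uses the palette shifted by [2 ^ j]. *)
Lemma pow2_coloring (A : Type) (f : A -> R) (j : nat) (L : list A) :
  NoDup L ->
  exists c : A -> nat,
    forall W, low_window A f L W -> (4 ^ j <= length W)%nat ->
      forall i, (i < 2 ^ j)%nat -> exists p, In p W /\ c p = i.
Proof.
  revert L. induction j as [|j IH]; intros L Hnd.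
  - exists (fun _ => 0%nat). intros [|a W] _ Hlen i Hi; simpl in *; [lia|].
    exists a. split; [now left|lia].
  - destruct (two_coloring A f L Hnd) as [c Hc].
    destruct (IH (filter c L)) as [c1 Hc1]; [now apply NoDup_filter|].
    destruct (IH (filter (fun p => negb (c p)) L)) as [c2 Hc2]; [now apply NoDup_filter|].
    exists (fun p => if c p then c1 p else (2 ^ j + c2 p)%nat).
    intros W HW Hlen i Hi. rewrite !Nat.pow_succ_r' in *.
    destruct (Nat.lt_ge_cases i (2 ^ j)) as [Hij|Hij].
    + destruct (Hc1 (filter c W)) with (i := i) as (p & Hp & E); auto.
      * now apply low_window_filter.
      * apply (low_window_count A f c L 4); auto.
      * apply filter_In in Hp as [Hp Hcp]. exists p. now rewrite Hcp.
    + destruct (Hc2 (filter (fun p => negb (c p)) W)) with (i := (i - 2 ^ j)%nat)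
        as (p & Hp & E); [| |lia|].
      * now apply low_window_filter.
      * apply (low_window_count A f (fun p => negb (c p)) L 4); auto.
        intros W' HW' Hlen'. destruct (Hc W' HW' Hlen' false) as (p & Hp & E).
        exists p. now rewrite E.
      * apply filter_In in Hp as [Hp Hcp]. exists p. split; [easy|].
        destruct (c p); [easy|lia].
Qed.

(** * Separating bottomless from topless rectangles *)

(** Here [true] is red and [false] is blue. The end points of the list are left free. *)
Record local_rule (A : Type) (f : A -> R) (L : list A) (c : A -> bool) : Prop := {
  local_min : forall X u p v Y, L = X ++ u :: p :: v :: Y ->
    f p < f u -> f p < f v -> c p = true;
  local_max : forall X u p v Y, L = X ++ u :: p :: v :: Y ->
    f u < f p -> f v < f p -> c p = false;
  ascending : forall X u p q v Y, L = X ++ u :: p :: q :: v :: Y ->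
    f u < f p -> f p < f q -> f q < f v -> c p = negb (c q);
  descending : forall X u p q v Y, L = X ++ u :: p :: q :: v :: Y ->
    f p < f u -> f q < f p -> f v < f q -> c p = negb (c q) }.

(** Turning the heights upside down exchanges minima with maxima and ascents with descents. Thus the
    argument for red points below also serves for blue points above. *)
Lemma local_rule_opp (A : Type) (f : A -> R) (L : list A) (c : A -> bool) :
  local_rule A f L c -> local_rule A (fun p => - f p) L (fun p => negb (c p)).
Proof.
  intros [Hmin Hmax Hasc Hdesc].
  split; intros X u p; [intros v Y E ? ?|intros v Y E ? ?|intros q v Y E ? ? ?..].
  - rewrite (Hmax _ _ _ _ _ E); (lra || easy).
  - rewrite (Hmin _ _ _ _ _ E); (lra || easy).
  - rewrite (Hdesc _ _ _ _ _ _ E); (lra || easy).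
  - rewrite (Hasc _ _ _ _ _ _ E); (lra || easy).
Qed.

Lemma local_rule_exists (A : Type) (f : A -> R) (L : list A) :
  NoDup L -> exists c : A -> bool, local_rule A f L c.
Proof.
  intros Hnd. destruct L as [|d L0].
  { exists (fun _ => true). split; intros [|] *; easy. }
  set (L := d :: L0) in *. set (h i := f (nth i L d)).
  (* Points that are not extremal are coloured by the parity of their position. At the two ends,
     [i - 1] truncates to 0 and [i + 1] reads the default [d], but no clause constrains end
     points. *)
  destruct (coloring_by_index A bool d (fun i =>
    if Rlt_dec (h i) (h (i - 1)%nat)
    then if Rlt_dec (h i) (h (i + 1)%nat) then true else Nat.even i
    else if Rlt_dec (h (i + 1)%nat) (h i) then false else Nat.even i) L Hnd) as [c Hc].
  exists c.
  assert (Hnth : forall X Z i, L = X ++ Z -> nth (length X + i) L d = nth i Z d)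
    by (intros X Z i ->; apply app_nth2_plus).
  assert (Hcp : forall X u p v Y, L = X ++ u :: p :: v :: Y -> c p =
    if Rlt_dec (f p) (f u)
    then if Rlt_dec (f p) (f v) then true else Nat.even (length X + 1)
    else if Rlt_dec (f v) (f p) then false else Nat.even (length X + 1)).
  { intros X u p v Y E.
    specialize (Hc (length X + 1)%nat). unfold h in Hc.
    replace (length X + 1 - 1)%nat with (length X + 0)%nat in Hc by lia.
    replace (length X + 1 + 1)%nat with (length X + 2)%nat in Hc by lia.
    rewrite !(Hnth _ _ _ E) in Hc. apply Hc.
    rewrite E, length_app. simpl. lia. }
  (* One position further the parity flips, which gives the alternation on monotone runs. *)
  assert (Hcq : forall X u p q v Y, L = X ++ u :: p :: q :: v :: Y -> c q =
    if Rlt_dec (f q) (f p)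
    then if Rlt_dec (f q) (f v) then true else Nat.odd (length X + 1)
    else if Rlt_dec (f v) (f q) then false else Nat.odd (length X + 1)).
  { intros X u p q v Y E. rewrite (Hcp (X ++ [u]) p q v Y) by now rewrite E, <- app_assoc.
    rewrite length_app. simpl.
    now rewrite !(Nat.add_comm _ 1), Nat.even_succ. }
  split.
  - intros X u p v Y E ? ?. rewrite (Hcp _ _ _ _ _ E).
    repeat destruct Rlt_dec; easy || lra.
  - intros X u p v Y E ? ?. rewrite (Hcp _ _ _ _ _ E).
    repeat destruct Rlt_dec; easy || lra.
  - intros X u p q v Y E ? ? ?. rewrite (Hcp _ _ _ _ _ E), (Hcq _ _ _ _ _ _ E).
    repeat destruct Rlt_dec; try lra. now rewrite Nat.negb_odd.
  - intros X u p q v Y E ? ? ?. rewrite (Hcp _ _ _ _ _ E), (Hcq _ _ _ _ _ _ E).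
    repeat destruct Rlt_dec; try lra. now rewrite Nat.negb_odd.
Qed.

Definition distinct_heights (A : Type) (f : A -> R) (L : list A) : Prop :=
  forall p q, In p L -> In q L -> f p = f q -> p = q.

Lemma distinct_adjacent (A : Type) (f : A -> R) (L X Y : list A) (p q : A) :
  NoDup L -> distinct_heights A f L -> L = X ++ p :: q :: Y -> f p <> f q.
Proof.
  intros Hnd Hf -> E.
  assert (p = q) as ->.
  { apply Hf; [| |easy]; rewrite in_app_iff; simpl; auto. }
  apply NoDup_remove_2 in Hnd. apply Hnd. rewrite in_app_iff. simpl. auto.
Qed.

(* Without a local minimum the six heights rise and then fall, so four consecutive ones are monotone. *)
Lemma six_adjacent (A : Type) (f : A -> R) (L X J Y : list A) (c : A -> bool) :
  NoDup L -> distinct_heights A f L -> local_rule A f L c ->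
  L = X ++ J ++ Y -> (6 <= length J)%nat -> exists p, In p J /\ c p = true.
Proof.
  intros Hnd Hf [Hmin _ Hasc Hdesc] E Hlen.
  destruct J as [|p0 [|p1 [|p2 [|p3 [|p4 [|p5 J]]]]]]; simpl in Hlen; try lia.
  assert (H : c p1 = true \/ c p2 = true \/ c p3 = true \/ c p4 = true).
  2:{ destruct H as [H|[H|[H|H]]]; eexists; (split; [|exact H]); simpl; tauto. }
  simpl in E.
  assert (E1 : L = (X ++ [p0]) ++ p1 :: p2 :: p3 :: p4 :: p5 :: J ++ Y)
    by now rewrite E, <- app_assoc.
  assert (E2 : L = (X ++ [p0; p1]) ++ p2 :: p3 :: p4 :: p5 :: J ++ Y)
    by now rewrite E, <- app_assoc.
  assert (E3 : L = (X ++ [p0; p1; p2]) ++ p3 :: p4 :: p5 :: J ++ Y)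
    by now rewrite E, <- app_assoc.
  assert (E4 : L = (X ++ [p0; p1; p2; p3]) ++ p4 :: p5 :: J ++ Y)
    by now rewrite E, <- app_assoc.
  pose proof (distinct_adjacent _ _ _ _ _ _ _ Hnd Hf E) as D0.
  pose proof (distinct_adjacent _ _ _ _ _ _ _ Hnd Hf E1) as D1.
  pose proof (distinct_adjacent _ _ _ _ _ _ _ Hnd Hf E2) as D2.
  pose proof (distinct_adjacent _ _ _ _ _ _ _ Hnd Hf E3) as D3.
  pose proof (distinct_adjacent _ _ _ _ _ _ _ Hnd Hf E4) as D4.
  pose proof (Hmin _ _ _ _ _ E) as M1. pose proof (Hmin _ _ _ _ _ E1) as M2.
  pose proof (Hmin _ _ _ _ _ E2) as M3. pose proof (Hmin _ _ _ _ _ E3) as M4.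
  pose proof (Hasc _ _ _ _ _ _ E) as A1. pose proof (Hasc _ _ _ _ _ _ E1) as A2.
  pose proof (Hasc _ _ _ _ _ _ E2) as A3.
  pose proof (Hdesc _ _ _ _ _ _ E) as B1. pose proof (Hdesc _ _ _ _ _ _ E1) as B2.
  pose proof (Hdesc _ _ _ _ _ _ E2) as B3.
  clear - D0 D1 D2 D3 D4 M1 M2 M3 M4 A1 A2 A3 B1 B2 B3.
  apply Rdichotomy in D0, D1, D2, D3, D4. unfold Rgt in *.
  destruct (c p1), (c p2), (c p3), (c p4); simpl in *; try tauto; exfalso;
  destruct D0, D1, D2, D3, D4;
    first [ discriminate M1; assumption | discriminate M2; assumption
          | discriminate M3; assumption | discriminate M4; assumption
          | discriminate A1; assumption | discriminate A2; assumption
          | discriminate A3; assumption | discriminate B1; assumption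
          | discriminate B2; assumption | discriminate B3; assumption ].
Qed.

(* The lowest point of [M] is a local minimum. *)
Lemma red_below (A : Type) (f : A -> R) (L X M Y : list A) (x p y : A) (c : A -> bool) :
  NoDup L -> distinct_heights A f L -> local_rule A f L c ->
  L = X ++ x :: M ++ y :: Y -> In p M -> f p < f x -> f p < f y ->
  exists q, In q M /\ f q <= f p /\ c q = true.
Proof.
  intros Hnd Hf [Hmin _ _ _] E Hp Hpx Hpy.
  destruct (exists_lowest A f M) as (q & Hq & Hlow); [now intros ->|].
  pose proof (Hlow p Hp) as Hqp.
  exists q. split; [easy|]. split; [easy|].
  destruct (in_split _ _ Hq) as (M1 & M2 & ->).
  (* The list neighbours [u] and [v] of [q] lie in [M] or are [x] and [y]; in either case they are
     higher than [q]. *)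
  assert (HM1 : exists X' u, X ++ x :: M1 = X' ++ [u] /\ (u = x \/ In u M1)).
  { destruct (exists_last (l := x :: M1)) as (X' & u & Eu); [easy|].
    exists (X ++ X'), u. split; [now rewrite Eu, app_assoc|].
    assert (Hu : In u (x :: M1)) by (rewrite Eu, in_app_iff; simpl; auto).
    destruct Hu; auto. }
  assert (HM2 : exists v Y', M2 ++ y :: Y = v :: Y' /\ (v = y \/ In v M2)).
  { destruct M2 as [|v M2]; [exists y, Y; auto|].
    exists v, (M2 ++ y :: Y). simpl. auto. }
  destruct HM1 as (X' & u & EX & Hu), HM2 as (v & Y' & EY & Hv).
  assert (E1 : L = X' ++ u :: q :: v :: Y').
  { rewrite E, <- EY. transitivity ((X' ++ [u]) ++ q :: M2 ++ y :: Y);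
      [rewrite <- EX|]; now rewrite <- !app_assoc; simpl; rewrite <- ?app_assoc. }
  assert (E2 : L = (X' ++ [u]) ++ q :: v :: Y') by now rewrite E1, <- app_assoc.
  apply (Hmin _ _ _ _ _ E1).
  - pose proof (distinct_adjacent _ _ _ _ _ _ _ Hnd Hf E1).
    destruct Hu as [->|Hu]; [lra|].
    specialize (Hlow u). rewrite in_app_iff in Hlow. specialize (Hlow (or_introl Hu)). lra.
  - pose proof (distinct_adjacent _ _ _ _ _ _ _ Hnd Hf E2).
    destruct Hv as [->|Hv]; [lra|].
    specialize (Hlow v). rewrite in_app_iff in Hlow. simpl in Hlow.
    specialize (Hlow (or_intror (or_intror Hv))). lra.
Qed.

(** Cut the interval of [L] spanned by the window at its first and last high points [x] and [y]. The
    outer parts [U] and [V] consist of adjacent low points, so six in one of them suffice. Otherwise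
    they hold at most ten, and an eleventh low point lies between [x] and [y], where [red_below]
    applies. *)
Lemma red_in_low_window (A : Type) (f : A -> R) (L W : list A) (c : A -> bool) :
  NoDup L -> distinct_heights A f L -> local_rule A f L c ->
  low_window A f L W -> (11 <= length W)%nat -> exists p, In p W /\ c p = true.
Proof.
  intros Hnd Hf Hc (b & P & S & HW) Hlen.
  (* The splitting is lifted from the low points to [L]: [I] is an interval of [L] whose low points
     are exactly [W]. *)
  apply filter_eq_app in HW as (P' & L' & E & _ & HW).
  apply filter_eq_app in HW as (I & S' & -> & HI & _).
  set (low := fun p => Rleb (f p) b) in *.
  assert (Hin : forall p, In p I -> low p = true -> In p W)
    by (intros p H1 H2; rewrite <- HI; now apply filter_In).
  assert (Hsix : forall X J Y, I = X ++ J ++ Y -> (forall p, In p J -> low p = true) ->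
    (6 <= length J)%nat -> exists p, In p W /\ c p = true).
  { intros X J Y EI HJ HlenJ.
    destruct (six_adjacent A f L (P' ++ X) J (Y ++ S') c) as (p & Hp & Hcp); auto.
    { now rewrite E, EI, <- !app_assoc. }
    exists p. split; [|easy]. apply Hin; auto. rewrite EI, !in_app_iff. auto. }
  destruct (first_false A low I) as [Hall|(U & x & I2 & EI & Hx & HU)].
  { apply (Hsix [] I []); [now rewrite app_nil_r|easy|].
    rewrite <- HI, filter_true in Hlen by easy. lia. }
  destruct (Nat.le_gt_cases 6 (length U)).
  { now apply (Hsix [] U (x :: I2)). }
  rewrite EI, filter_app, (filter_true _ _ U HU) in HI. simpl in HI. rewrite Hx in HI.
  destruct (last_false A low I2) as [Hall|(M & y & V & EI2 & Hy & HV)].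
  { apply (Hsix (U ++ [x]) I2 []); [now rewrite EI, app_nil_r, <- app_assoc|easy|].
    rewrite <- HI, filter_true, length_app in Hlen by easy. lia. }
  destruct (Nat.le_gt_cases 6 (length V)).
  { apply (Hsix (U ++ x :: M ++ [y]) V []); [|easy|easy].
    rewrite EI, EI2, app_nil_r, <- !app_assoc. simpl. now rewrite <- app_assoc. }
  rewrite EI2, filter_app in HI. simpl in HI. rewrite Hy, (filter_true _ _ V HV) in HI.
  destruct (filter low M) as [|p M'] eqn:EM.
  { rewrite <- HI, !length_app in Hlen. simpl in Hlen. lia. }
  assert (HpM : In p (filter low M)) by (rewrite EM; now left).
  apply filter_In in HpM as [HpM Hlp].
  unfold low in Hx, Hy, Hlp. apply Rleb_false in Hx, Hy. apply Rleb_true in Hlp.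
  destruct (red_below A f L (P' ++ U) M (V ++ S') x p y c) as (q & Hq & Hqp & Hcq);
    auto; try lra.
  { rewrite E, EI, EI2, <- !app_assoc. simpl. now rewrite <- app_assoc. }
  exists q. split; [|easy]. apply Hin.
  - rewrite EI, EI2, !in_app_iff. simpl. rewrite in_app_iff. auto.
  - apply Rleb_true. lra.
Qed.

(** * Rectangles *)

Lemma Sorted_permutation (V : list point) :
  exists L, Permutation V L /\ StronglySorted (fun p q => fst p <= fst q) L.
Proof.
  induction V as [|a V (L & HP & HL)]; [exists []; split; constructor|].
  assert (H : exists L', Permutation (a :: L) L' /\
    StronglySorted (fun p q : point => fst p <= fst q) L').
  { clear HP. induction HL as [|b L HL IH Hb].
    - exists [a]. repeat constructor.
    - destruct (Rle_dec (fst a) (fst b)) as [Hab|Hab].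
      + exists (a :: b :: L). split; [easy|]. repeat (constructor; try easy).
        revert Hb. apply Forall_impl. intros q. lra.
      + destruct IH as (L' & HP & HL').
        exists (b :: L'). split.
        * rewrite perm_swap. now constructor.
        * constructor; [easy|]. rewrite <- HP. constructor; [lra|easy]. }
  destruct H as (L' & HP' & HL'). exists L'. split; [|easy].
  now rewrite HP.
Qed.

Lemma left_prefix (L : list point) (a : R) :
  StronglySorted (fun p q => fst p <= fst q) L ->
  exists S, L = filter (fun p => Rleb (fst p) a) L ++ S.
Proof.
  induction 1 as [|b L HL (S & IH) Hb]; [exists []; easy|].
  rewrite Forall_forall in Hb. simpl.
  destruct (Rleb (fst b) a) eqn:E; [exists S; simpl; now f_equal|].
  exists (b :: L). destruct (filter _ L) as [|q W] eqn:EW; [easy|]. exfalso.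
  assert (Hq : In q (q :: W)) by now left.
  rewrite <- EW in Hq. apply filter_In in Hq as [Hq Hqa].
  apply Rleb_true in Hqa. apply Rleb_false in E. specialize (Hb q Hq). lra.
Qed.

Lemma strip_window (L : list point) (a1 a2 : R) :
  StronglySorted (fun p q => fst p <= fst q) L ->
  exists P S, L = P ++ filter (fun p => Rleb a1 (fst p) && Rleb (fst p) a2)%bool L ++ S.
Proof.
  induction 1 as [|a L HL (P & S & IH) Ha]; [exists [], []; easy|].
  destruct (Rleb a1 (fst a)) eqn:E.
  (* From the first point with x-coordinate at least [a1] on, only the right bound matters, so the
     strip is a prefix. *)
  - destruct (left_prefix (a :: L) a2) as [S' HS']; [now constructor|].
    exists [], S'. rewrite HS' at 1. rewrite app_nil_l. f_equal. apply filter_ext_in.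
    intros p Hp. rewrite Forall_forall in Ha.
    rewrite (proj2 (Rleb_true a1 (fst p))); [easy|]. apply Rleb_true in E.
    destruct Hp as [<-|Hp]; [easy|]. specialize (Ha p Hp). lra.
  - exists (a :: P), S. simpl. rewrite E. simpl. now f_equal.
Qed.

Lemma StronglySorted_filter (A : Type) (r : A -> A -> Prop) (g : A -> bool) (L : list A) :
  StronglySorted r L -> StronglySorted r (filter g L).
Proof.
  induction 1 as [|a L HL IH Ha]; simpl; [constructor|].
  destruct (g a); [|easy]. constructor; [easy|].
  apply (incl_Forall (incl_filter g L) Ha).
Qed.

Lemma strip_low_window (f : point -> R) (L : list point) (a1 a2 b : R) :
  StronglySorted (fun p q => fst p <= fst q) L ->
  low_window point f L
    (filter (fun p => Rleb a1 (fst p) && Rleb (fst p) a2 && Rleb (f p) b)%bool L).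
Proof.
  intros HL.
  destruct (strip_window (filter (fun p => Rleb (f p) b) L) a1 a2) as (P & S & H).
  { now apply StronglySorted_filter. }
  exists b, P, S. rewrite filter_andb. exact H.
Qed.

Lemma filter_permutation (A : Type) (g : A -> bool) (l l' : list A) :
  Permutation l l' -> Permutation (filter g l) (filter g l').
Proof.
  induction 1 as [|a l l' _ IH|a b l|l l' l'' _ IH1 _ IH2]; simpl; auto.
  - destruct (g a); auto.
  - destruct (g a), (g b); auto. constructor.
  - now transitivity (filter g l').
Qed.

(** A bottomless window of [11 * 4 ^ j] points has [4 ^ j] red points and a topless one [4 ^ j] blue
    points. Each class is coloured for its own family only. *)
Lemma good_m_pow4 (k j : nat) : (1 <= k <= 2 ^ j)%nat -> good_m k (11 * 4 ^ j).
Proof.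
  intros Hk V HndV Hgen.
  destruct (Sorted_permutation V) as (L & HP & HL).
  assert (Hnd : NoDup L) by now apply (Permutation_NoDup HP).
  assert (Hdist : distinct_heights point snd L).
  { intros p q Hp Hq E. destruct (excluded_middle_informative (p = q)) as [|Hpq]; [easy|].
    apply (Permutation_in _ (Permutation_sym HP)) in Hp, Hq.
    now destruct (Hgen p q Hp Hq Hpq) as (_ & H & _). }
  destruct (local_rule_exists point snd L Hnd) as [red Hred].
  set (blue p := negb (red p)).
  destruct (pow2_coloring point snd j (filter red L)) as [cR HcR]; [now apply NoDup_filter|].
  destruct (pow2_coloring point (fun p => - snd p) j (filter blue L)) as [cB HcB];
    [now apply NoDup_filter|].
  set (c p := if red p then cR p else cB p).
  (* Surplus colours from [k] on are merged into colour 0. *)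
  exists (fun p => if (c p <? k)%nat then c p else 0%nat). split.
  { intros p _. destruct (Nat.ltb_spec (c p) k); lia. }
  intros r Hr i Hi.
  assert (HPr : Permutation (cut V r) (cut L r)) by now apply filter_permutation.
  rewrite (Permutation_length HPr) in Hr.
  enough (exists p, In p (cut L r) /\ c p = i) as (p & Hp & Hcp).
  { exists p. split; [now apply (Permutation_in _ (Permutation_sym HPr))|].
    rewrite Hcp. now apply Nat.ltb_lt in Hi as ->. }
  assert (Hij : (i < 2 ^ j)%nat) by lia.
  destruct r as [a1 a2 b|a1 a2 b].
  - assert (HW : low_window point snd L (cut L (BL a1 a2 b)))
      by apply (strip_low_window snd L a1 a2 b HL).
    destruct (HcR (filter red (cut L (BL a1 a2 b)))) with (i := i) as (p & Hp & Hcp); auto.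
    + now apply low_window_filter.
    + apply (low_window_count point snd red L 11); [|easy|lia].
      intros W HW' Hlen. now apply (red_in_low_window point snd L).
    + apply filter_In in Hp as [Hp Hrp]. exists p. unfold c. now rewrite Hrp.
  - assert (HW : low_window point (fun p => - snd p) L (cut L (TL a1 a2 b))).
    { replace (cut L (TL a1 a2 b)) with
        (filter (fun p => Rleb a1 (fst p) && Rleb (fst p) a2 && Rleb (- snd p) (- b))%bool L).
      - now apply (strip_low_window (fun p => - snd p)).
      - apply filter_ext. intros p. now rewrite Rleb_opp. }
    destruct (HcB (filter blue (cut L (TL a1 a2 b)))) with (i := i) as (p & Hp & Hcp); auto.
    + now apply low_window_filter.
    + apply (low_window_count point (fun p => - snd p) blue L 11); [|easy|lia].
      intros W HW' Hlen. apply (red_in_low_window point (fun p => - snd p) L); auto.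
      * intros p q Hp Hq E. apply Hdist; [easy|easy|lra].
      * now apply local_rule_opp.
    + apply filter_In in Hp as [Hp Hbp]. exists p. split; [easy|].
      unfold c, blue in *. now destruct (red p).
Qed.

(* m_R(k) <= C k^{8.75}: the least good m is at most the bound, i.e. some good m is. *)
Theorem theorem11 :
  exists C : R, forall k : nat, (1 <= k)%nat ->
    exists m : nat, good_m k m /\ INR m <= C * Rpower (INR k) (35 / 4).
Proof.
  (* Rounding [k] up to a power of two at most doubles it, so the size is at most 11 times
     [(2 * k) ^ 2], that is [44 * k ^ 2]. *)
  exists 44. intros k Hk. exists (11 * 4 ^ Nat.log2_up k)%nat. split.
  - apply good_m_pow4. split; [easy|]. now apply Nat.log2_log2_up_spec.
  - assert (H : (2 ^ Nat.log2_up k <= 2 * k)%nat).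
    { destruct (Nat.eq_dec k 1) as [->|Hk1]; [simpl; lia|].
      destruct (Nat.log2_up_spec k) as [Hlow _]; [lia|].
      assert (Hpos : (0 < Nat.log2_up k)%nat) by (apply Nat.log2_up_pos; lia).
      rewrite <- (Nat.succ_pred_pos _ Hpos), Nat.pow_succ_r'. lia. }
    assert (H4 : (11 * 4 ^ Nat.log2_up k <= 44 * k ^ 2)%nat).
    { replace (4 ^ Nat.log2_up k)%nat with (2 ^ Nat.log2_up k * 2 ^ Nat.log2_up k)%nat
        by now rewrite <- Nat.pow_mul_l.
      simpl (k ^ 2)%nat. nia. }
    apply le_INR in H4. rewrite (mult_INR 44), pow_INR in H4.
    assert (HkR : 1 <= INR k) by now apply (le_INR 1).
    (* The quadratic bound is weakened to the exponent 35/4, using that [k] is at least 1. *)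
    assert (HP : INR k ^ 2 <= Rpower (INR k) (35 / 4)).
    { rewrite <- Rpower_pow by lra. apply Rle_Rpower; [easy|]. simpl. lra. }
    replace (INR 44) with 44 in H4 by (simpl; lra). lra.
Qed.
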